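(* Let $y,z$ be complex numbers with $|y|<1$ and $|z|<1$. Then $$\prod_{\substack{m,n \geq 1 \\ m \leq n,\ \gcd(m,n)=1}} \left( \frac{1}{1- y^m z^n} \right)^{\frac{m}{n^2}} = \left(1-yz\right)^{\frac{y}{1-y}} \exp\left\{ \frac{y}{(1-y)^2} \left(Li_2(z)- Li_2(yz)\right) \right\},$$ and $$\prod_{\substack{m,n \geq 1 \\ m \leq n,\ \gcd(m,n)=1}} \left(1- y^m z^n\right)^{\frac{m}{n^2}} = \left(\frac{1}{1-yz}\right)^{\frac{y}{1-y}} \exp\left\{- \frac{y}{(1-y)^2} \left(Li_2(z)- Li_2(yz)\right) \right\}.$$
   Context: The products run over all pairs of positive integers $(m,n)$ with $m\le n$ and $\gcd(m,n)=1$. $Li_2(w)=\sum_{r\ge1} w^r/r^2$ is the dilogarithm. Complex powers are taken with the principal branch, i.e. $(1-w)^{\alpha}=\exp(\alpha\log(1-w))$ with the principal logarithm. *)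

(* Defs.v *)
From Stdlib Require Export Reals List PeanoNat.
From Coquelicot Require Export Coquelicot.
Open Scope R_scope.
Open Scope C_scope.

Definition Cexp (z : C) : C := (exp (Re z) * (cos (Im z), sin (Im z)))%C.

(* The argument in (-PI, PI]; meaningless at 0. *)
Definition Carg (z : C) : R :=
  if Rle_dec 0 (Im z) then acos (Re z / Cmod z) else (- acos (Re z / Cmod z))%R.

(* The principal logarithm; meaningless at 0. *)
Definition Clog (z : C) : C := (ln (Cmod z), Carg z).

(* Principal branch of w ^ a for w <> 0. *)
Definition Cpower (w a : C) : C := Cexp (a * Clog w).

(* Summed componentwise, Coquelicot's [Series] being real-valued; this is the
   limit of [is_series a] in [C] whenever that limit exists. *)
Definition CSeries (a : nat -> C) : C :=
  (Series (fun k => Re (a k)), Series (fun k => Im (a k))).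

Definition Li2 (w : C) : C :=
  CSeries (fun k => w ^ (S k) / RtoC (INR (S k)) ^ 2).

Definition Cprod {I : Type} (s : list I) (f : I -> C) : C :=
  fold_right (fun i p => f i * p) (RtoC 1) s.

(* [is_Cprod P f l]: the infinite product of [f i] over the indices [i]
   satisfying [P] converges unconditionally to [l], i.e. the products over
   finite subsets of [P] (as duplicate-free lists) converge to [l] along
   inclusion, so no enumeration of the index set is chosen. *)
Definition is_Cprod {I : Type} (P : I -> Prop) (f : I -> C) (l : C) : Prop :=
  forall eps : posreal, exists s0 : list I,
    NoDup s0 /\ List.Forall P s0 /\
    forall s : list I, NoDup s -> List.Forall P s -> incl s0 s ->
      Cmod (Cprod s f - l) < eps.

Definition coprime_le_pair (p : nat * nat) : Prop :=
  let (m, n) := p in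
  (1 <= m)%nat /\ (1 <= n)%nat /\ (m <= n)%nat /\ Nat.gcd m n = 1%nat.

(* Main.v *)
(* Expanding the logarithms, the sum of [- m / n^2 * log (1 - y^m z^n)] over
   coprime pairs [m <= n] is the sum of [M / N^2 * y^M z^N] over all pairs
   [1 <= M <= N], since every such pair is uniquely [(k m, k n)] with [m, n]
   coprime. The double series converges absolutely, so finite sets of coprime
   pairs may be compared with the triangles [M <= N <= K]; there the inner sum
   over [M] has a closed form, and summing over [N] yields
   [y / (1-y)^2 * (Li2 z - Li2 (y z)) + y / (1-y) * log (1 - y z)].
   Both products follow by exponentiating this sum and its opposite. *)

From Stdlib Require Import Lra Lia Permutation.
Require Import Defs.

(** * Finite sums *)

Definition Csum {I : Type} (s : list I) (f : I -> C) : C :=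
  fold_right (fun i a => f i + a) (RtoC 0) s.

Definition Rsum {I : Type} (s : list I) (f : I -> R) : R :=
  fold_right (fun i a => f i + a)%R 0%R s.

Lemma Csum_app {I} (s t : list I) f : Csum (s ++ t) f = Csum s f + Csum t f.
Proof. induction s as [|i s IH]; simpl; [|rewrite IH]; ring. Qed.

Lemma Rsum_app {I} (s t : list I) f : Rsum (s ++ t) f = (Rsum s f + Rsum t f)%R.
Proof. induction s as [|i s IH]; simpl; [|rewrite IH]; ring. Qed.

Lemma Csum_permut {I} (s t : list I) f : Permutation s t -> Csum s f = Csum t f.
Proof.
  induction 1; simpl; [reflexivity | now rewrite IHPermutation | ring | congruence].
Qed.

Lemma Rsum_permut {I} (s t : list I) f : Permutation s t -> Rsum s f = Rsum t f.
Proof.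
  induction 1; simpl; [reflexivity | now rewrite IHPermutation | ring | congruence].
Qed.

Lemma Csum_ext {I} (s : list I) f g :
  (forall i, In i s -> f i = g i) -> Csum s f = Csum s g.
Proof.
  induction s as [|i s IH]; simpl; intros H; [reflexivity|].
  rewrite H, IH; auto.
Qed.

Lemma Csum_map {I J} (h : I -> J) (s : list I) f :
  Csum (map h s) f = Csum s (fun i => f (h i)).
Proof. induction s as [|i s IH]; simpl; [reflexivity | now rewrite IH]. Qed.

Lemma Rsum_map {I J} (h : I -> J) (s : list I) f :
  Rsum (map h s) f = Rsum s (fun i => f (h i)).
Proof. induction s as [|i s IH]; simpl; [reflexivity | now rewrite IH]. Qed.

Lemma Csum_flat_map {I J} (h : I -> list J) (s : list I) f :
  Csum (flat_map h s) f = Csum s (fun i => Csum (h i) f).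
Proof.
  induction s as [|i s IH]; simpl; [reflexivity | now rewrite Csum_app, IH].
Qed.

Lemma Csum_scal {I} (s : list I) c f : Csum s (fun i => c * f i) = c * Csum s f.
Proof. induction s as [|i s IH]; simpl; [|rewrite IH]; ring. Qed.

Lemma Csum_opp {I} (s : list I) f : Csum s (fun i => - f i) = - Csum s f.
Proof. induction s as [|i s IH]; simpl; [|rewrite IH]; ring. Qed.

Lemma Csum_seq_S n f : Csum (seq 1 (S n)) f = Csum (seq 1 n) f + f (S n).
Proof. rewrite seq_S, Csum_app; simpl; ring. Qed.

Lemma Cmod_Csum {I} (s : list I) f :
  (Cmod (Csum s f) <= Rsum s (fun i => Cmod (f i)))%R.
Proof.
  induction s as [|i s IH]; simpl; [rewrite Cmod_0; lra|].
  eapply Rle_trans; [apply Cmod_triangle | lra].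
Qed.

Lemma Rsum_ge_0 {I} (s : list I) f : (forall i, 0 <= f i)%R -> (0 <= Rsum s f)%R.
Proof.
  intros H; induction s as [|i s IH]; simpl; [lra | specialize (H i); lra].
Qed.

(** The remainder [r] turns a comparison of two nested sums into a statement about one sum. The head
    of [s] is cut out of [t]; since [s] has no duplicates, its tail still lies in what is left. *)
Lemma Permutation_incl {I} (s t : list I) :
  NoDup s -> incl s t -> exists r, Permutation t (s ++ r).
Proof.
  revert t; induction s as [|i s IH]; intros t Hs Hi; [now exists t|].
  inversion Hs as [|? ? Hn Hs']; subst.
  destruct (in_split i t) as [t1 [t2 ->]]; [now apply Hi; left|].
  destruct (IH (t1 ++ t2)) as [r Hr]; [assumption| |].
  - intros j Hj; assert (Hj' := Hi j (or_intror Hj)).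
    rewrite in_app_iff in *; simpl in Hj'; destruct Hj' as [|[->|]]; tauto.
  - exists r; simpl; rewrite <- Hr; symmetry; apply Permutation_middle.
Qed.

Lemma Rsum_incl {I} (s t : list I) f :
  (forall i, 0 <= f i)%R -> NoDup s -> incl s t -> (Rsum s f <= Rsum t f)%R.
Proof.
  intros Hf Hs Hi; destruct (Permutation_incl s t Hs Hi) as [r Hr].
  rewrite (Rsum_permut _ _ _ Hr), Rsum_app.
  generalize (Rsum_ge_0 r f Hf); lra.
Qed.

(** Both differences are sums over the same remainder of [t], so this is the triangle inequality
    there. It lets real tails control complex ones. *)
Lemma Cmod_Csum_incl_sub {I} (s t : list I) f :
  NoDup s -> incl s t ->
  (Cmod (Csum t f - Csum s f)
     <= Rsum t (fun i => Cmod (f i)) - Rsum s (fun i => Cmod (f i)))%R.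
Proof.
  intros Hs Hi; destruct (Permutation_incl s t Hs Hi) as [r Hr].
  rewrite (Csum_permut _ _ _ Hr), (Rsum_permut _ _ _ Hr), Csum_app, Rsum_app.
  replace (Csum s f + Csum r f - Csum s f) with (Csum r f) by ring.
  generalize (Cmod_Csum r f); lra.
Qed.

(** * Limits of complex sequences *)

(** Phrased through real distances, so that squeezing and the real limit laws apply directly. *)
Definition is_Clim (u : nat -> C) (l : C) : Prop :=
  is_lim_seq (fun n => Cmod (u n - l)) 0%R.

Lemma is_Clim_le (u : nat -> C) l (e : nat -> R) :
  (forall n, Cmod (u n - l) <= e n)%R -> is_lim_seq e 0%R -> is_Clim u l.
Proof.
  intros H He; apply is_lim_seq_le_le with (fun _ => 0%R) e; auto.
  - intros n; split; [apply Cmod_ge_0 | apply H].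
  - apply is_lim_seq_const.
Qed.

Lemma is_Clim_ext u v l : (forall n, u n = v n) -> is_Clim u l -> is_Clim v l.
Proof.
  intros H; apply is_lim_seq_ext; intros n; now rewrite H.
Qed.

Lemma is_Clim_const l : is_Clim (fun _ => l) l.
Proof.
  apply is_Clim_le with (fun _ => 0%R); [|apply is_lim_seq_const].
  intros _; replace (l - l) with (RtoC 0) by ring; rewrite Cmod_0; lra.
Qed.

Lemma is_Clim_plus u v a b :
  is_Clim u a -> is_Clim v b -> is_Clim (fun n => u n + v n) (a + b).
Proof.
  intros Hu Hv.
  apply is_Clim_le with (fun n => Cmod (u n - a) + Cmod (v n - b))%R.
  - intros n; replace (u n + v n - (a + b)) with ((u n - a) + (v n - b)) by ring.
    apply Cmod_triangle.
  - replace 0%R with (0 + 0)%R by ring; now apply is_lim_seq_plus'.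
Qed.

Lemma is_Clim_scal c u a : is_Clim u a -> is_Clim (fun n => c * u n) (c * a).
Proof.
  intros Hu; apply is_Clim_le with (fun n => Cmod c * Cmod (u n - a))%R.
  - intros n; replace (c * u n - c * a) with (c * (u n - a)) by ring.
    rewrite Cmod_mult; lra.
  - replace 0%R with (Cmod c * 0)%R by ring; now apply is_lim_seq_mult';
      [apply is_lim_seq_const|].
Qed.

Lemma is_Clim_Csum {I} (s : list I) (u : I -> nat -> C) (l : I -> C) :
  (forall i, In i s -> is_Clim (u i) (l i)) ->
  is_Clim (fun n => Csum s (fun i => u i n)) (Csum s l).
Proof.
  induction s as [|i s IH]; simpl; intros H; [apply is_Clim_const|].
  apply is_Clim_plus; auto.
Qed.

Lemma Cmod_le_abs (z : C) : (Cmod z <= Rabs (Re z) + Rabs (Im z))%R.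
Proof.
  replace z with (RtoC (Re z) + Ci * RtoC (Im z)) at 1.
  - eapply Rle_trans; [apply Cmod_triangle|].
    rewrite Cmod_mult, !Cmod_R.
    replace (Cmod Ci) with 1%R; [lra|].
    unfold Cmod, Ci; simpl; replace (0 * (0 * 1) + 1 * (1 * 1))%R with 1%R by ring.
    now rewrite sqrt_1.
  - destruct z; unfold Ci, Cplus, Cmult, Re, Im; simpl; f_equal; ring.
Qed.

Lemma im_le_Cmod (z : C) : (Rabs (Im z) <= Cmod z)%R.
Proof. eapply Rle_trans; [apply Rmax_r | apply Rmax_Cmod]. Qed.

Lemma is_Clim_components (u : nat -> C) (a b : R) :
  is_lim_seq (fun n => Re (u n)) a -> is_lim_seq (fun n => Im (u n)) b ->
  is_Clim u (a, b).
Proof.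
  intros Ha Hb.
  apply is_Clim_le with (fun n => Rabs (Re (u n) - a) + Rabs (Im (u n) - b))%R.
  - intros n; eapply Rle_trans; [apply Cmod_le_abs | apply Req_le; reflexivity].
  - replace (Finite 0) with (Finite (Rabs 0 + Rabs 0)) by (rewrite Rabs_R0; f_equal; ring).
    apply is_lim_seq_plus'; apply (is_lim_seq_abs _ (Finite 0)).
    + replace 0%R with (a - a)%R by ring.
      apply is_lim_seq_minus'; [assumption | apply is_lim_seq_const].
    + replace 0%R with (b - b)%R by ring.
      apply is_lim_seq_minus'; [assumption | apply is_lim_seq_const].
Qed.

(** * The principal logarithm, the dilogarithm and the exponential *)

Lemma one_minus_neq_0 (w : C) : (Cmod w < 1)%R -> 1 - w <> 0.
Proof.
  intros H E; replace w with (RtoC 1) in H; [rewrite Cmod_1 in H; lra|].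
  replace w with (1 - (1 - w)) by ring; rewrite E; ring.
Qed.

Lemma Cmod_one_minus (w : C) : (1 - Cmod w <= Cmod (1 - w))%R.
Proof.
  generalize (Cmod_triangle (1 - w) w); replace (1 - w + w) with (RtoC 1) by ring.
  rewrite Cmod_1; lra.
Qed.

Lemma Re_one_minus_pos (w : C) : (Cmod w < 1)%R -> (0 < Re (1 - w))%R.
Proof.
  intros H; generalize (re_le_Cmod w); intros H'; apply Rabs_le_between in H'.
  destruct w; unfold Cminus, Cplus, Copp, Re in *; simpl in *; lra.
Qed.

(* Turns the argument into a smooth function on the right half plane. *)
Lemma Carg_atan (w : C) : (0 < Re w)%R -> Carg w = atan (Im w / Re w).
Proof.
  destruct w as [x y]; unfold Carg, Re, Im, Cmod; simpl; intros Hx.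
  assert (Hs : (0 < x * (x * 1) + y * (y * 1))%R) by nra.
  set (s := (x * (x * 1) + y * (y * 1))%R) in *.
  assert (Hr : (0 < sqrt s)%R) by now apply sqrt_lt_R0.
  assert (Hrr : (sqrt s * sqrt s = s)%R) by (apply sqrt_sqrt; lra).
  assert (E : acos (x / sqrt s) = atan (Rabs y / x)).
  { rewrite acos_atan by now apply Rdiv_lt_0_compat.
    f_equal.
    replace (1 - (x / sqrt s)²)%R with ((Rabs y / sqrt s)²)%R.
    - rewrite sqrt_Rsqr; [field; lra|].
      apply Rmult_le_pos; [apply Rabs_pos | left; now apply Rinv_0_lt_compat].
    - rewrite !Rsqr_div', <- Rsqr_abs; unfold Rsqr; rewrite Hrr; unfold s; field.
      fold s; unfold s in Hs; lra. }
  rewrite E; destruct (Rle_dec 0 y).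
  - now rewrite Rabs_right by lra.
  - rewrite Rabs_left, <- atan_opp by lra; f_equal; field; lra.
Qed.

(** The half comes from the square root in the modulus. Both components become elementary real
    functions that can be differentiated. *)
Lemma Clog_re_pos (w : C) : (0 < Re w)%R ->
  Clog w = (ln (Re w ^ 2 + Im w ^ 2) / 2, atan (Im w / Re w))%R.
Proof.
  intros H; unfold Clog; rewrite Carg_atan by assumption; f_equal.
  unfold Cmod; fold (Re w) (Im w).
  assert (Hq : (0 < Re w ^ 2 + Im w ^ 2)%R) by nra.
  rewrite <- (sqrt_sqrt (Re w ^ 2 + Im w ^ 2)) at 2 by lra.
  rewrite ln_mult by now apply sqrt_lt_R0.
  lra.
Qed.

(** Inversion is conjugation up to a positive factor, so it preserves the right half plane, where
    the argument is an odd arctangent. The identity fails on the negative real axis, where the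
    argument is [PI] on both sides. *)
Lemma Clog_inv (w : C) : (0 < Re w)%R -> Clog (1 / w) = - Clog w.
Proof.
  destruct w as [x y]; intros Hx.
  assert (Hw : (x, y) <> RtoC 0) by (intros [=]; simpl in Hx; lra).
  simpl in Hx.
  assert (Hs : (0 < x ^ 2 + y ^ 2)%R) by nra.
  assert (Hre : Re (1 / (x, y)) = (x / (x ^ 2 + y ^ 2))%R)
    by (unfold Cdiv, Cmult, Cinv, Re; simpl; field; nra).
  assert (Him : Im (1 / (x, y)) = (- y / (x ^ 2 + y ^ 2))%R)
    by (unfold Cdiv, Cmult, Cinv, Im; simpl; field; nra).
  assert (Hp : (0 < Re (1 / (x, y)))%R) by (rewrite Hre; now apply Rdiv_lt_0_compat).
  unfold Clog; rewrite Carg_atan, Carg_atan, Hre, Him by assumption.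
  unfold Cdiv; rewrite Cmult_1_l, Cmod_inv by assumption.
  unfold Copp; simpl fst; simpl snd; f_equal.
  - rewrite ln_Rinv; [reflexivity|]; now apply Cmod_gt_0.
  - rewrite <- atan_opp; f_equal; simpl; field; nra.
Qed.

(** * Power series of the logarithm and the dilogarithm *)

(** Along a ray the variable is real, so differentiating the two components replaces complex
    differentiability. *)
Lemma is_derive_Clog_ray (w : C) (t : R) : (0 < Re (1 - t * w))%R ->
  is_derive (fun t : R => Re (Clog (1 - t * w))) t (Re (- w / (1 - t * w))) /\
  is_derive (fun t : R => Im (Clog (1 - t * w))) t (Im (- w / (1 - t * w))).
Proof.
  destruct w as [a b]; intros H.
  assert (E : forall t : R, 1 - t * (a, b) = (1 - t * a, - (t * b))%R).
  { intros s; unfold Cminus, Cplus, Copp, Cmult, RtoC; simpl; f_equal; ring. }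
  rewrite E in *; simpl in H.
  (* Positivity of [1 - s * a] is an open condition, so the closed form agrees with [Clog] on a
     whole neighbourhood of [t], as differentiation requires. *)
  assert (Hl : locally t (fun s : R =>
    (ln ((1 - s * a) ^ 2 + (- (s * b)) ^ 2) / 2, atan (- (s * b) / (1 - s * a)))%R
     = Clog (1 - s * (a, b)))).
  { apply filter_imp with (fun s : R => (0 < 1 - s * a)%R).
    - intros s Hs; rewrite E, Clog_re_pos; [reflexivity | exact Hs].
    - assert (Hc : continuous (fun s : R => (1 - s * a)%R) t).
      { apply (ex_derive_continuous (fun s : R => (1 - s * a)%R)); auto_derive; auto. }
      apply Hc; now apply (open_gt 0%R). }
  assert (Hq : (0 < (1 - t * a) ^ 2 + (- (t * b)) ^ 2)%R) by nra.
  assert (Ew : - (a, b) / (1 - t * a, - (t * b))%R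
    = ((- a * (1 - t * a) + t * b * b) / ((1 - t * a) ^ 2 + (- (t * b)) ^ 2),
       - b / ((1 - t * a) ^ 2 + (- (t * b)) ^ 2))%R).
  { unfold Cdiv, Cmult, Cinv, Copp; simpl; f_equal; field; nra. }
  rewrite Ew; split.
  - apply (is_derive_ext_loc
      (fun s : R => ln ((1 - s * a) ^ 2 + (- (s * b)) ^ 2) / 2)%R).
    + eapply filter_imp; [|exact Hl]; intros s Hs; exact (f_equal Re Hs).
    + auto_derive; [nra|]; simpl; field; nra.
  - apply (is_derive_ext_loc (fun s : R => atan (- (s * b) / (1 - s * a)))).
    + eapply filter_imp; [|exact Hl]; intros s Hs; exact (f_equal Im Hs).
    + auto_derive; [nra|]; unfold Rsqr; simpl; field; repeat split; nra.
Qed.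

Lemma RtoC_INR_S_neq_0 n : RtoC (INR (S n)) <> 0.
Proof. intros H; apply RtoC_inj in H; revert H; apply not_0_INR; discriminate. Qed.

Lemma is_derive_log_sum_ray (w : C) (n : nat) (t : R) :
  is_derive (fun t : R => Re (Csum (seq 1 n) (fun k => (t * w) ^ k / INR k))) t
    (Re (Csum (seq 1 n) (fun k => t ^ pred k * w ^ k))) /\
  is_derive (fun t : R => Im (Csum (seq 1 n) (fun k => (t * w) ^ k / INR k))) t
    (Im (Csum (seq 1 n) (fun k => t ^ pred k * w ^ k))).
Proof.
  (* Separates the real factor carrying the variable from the constant [w ^ S k]; only a real
     monomial is left to differentiate. *)
  assert (E : forall (s : R) k, (s * w) ^ S k / INR (S k) = RtoC (s ^ S k / INR (S k)) * w ^ S k).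
  { intros s k; rewrite RtoC_div, RtoC_pow, Cpow_mult_l by (apply not_0_INR; discriminate).
    field; apply RtoC_INR_S_neq_0. }
  induction n as [|n [IHr IHi]]; [split; apply (is_derive_const 0%R)|].
  assert (Hd : is_derive (fun s : R => s ^ S n / INR (S n))%R t (t ^ n)%R).
  { auto_derive; [auto|]; simpl pred; field.
    exact (not_0_INR (S n) (Nat.neq_succ_0 n)). }
  rewrite Csum_seq_S; simpl pred; rewrite <- RtoC_pow.
  split.
  - apply is_derive_ext with (fun s : R =>
      Re (Csum (seq 1 n) (fun k => (s * w) ^ k / INR k)%C)
      + s ^ S n / INR (S n) * Re (w ^ S n))%R.
    + intros s; rewrite Csum_seq_S, E, <- re_scal_l; reflexivity.
    + change (Re (?a + ?b)) with (Re a + Re b)%R; rewrite re_scal_l.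
      apply @is_derive_plus; [exact IHr|].
      exact (@is_derive_scal_l R_AbsRing R_NormedModule _ _ _ (Re (w ^ S n)) Hd).
  - apply is_derive_ext with (fun s : R =>
      Im (Csum (seq 1 n) (fun k => (s * w) ^ k / INR k)%C)
      + s ^ S n / INR (S n) * Im (w ^ S n))%R.
    + intros s; rewrite Csum_seq_S, E, <- im_scal_l; reflexivity.
    + change (Im (?a + ?b)) with (Im a + Im b)%R; rewrite im_scal_l.
      apply @is_derive_plus; [exact IHi|].
      exact (@is_derive_scal_l R_AbsRing R_NormedModule _ _ _ (Im (w ^ S n)) Hd).
Qed.

Lemma geom_sum_ray (w t : C) (n : nat) :
  (1 - t * w) * Csum (seq 1 n) (fun k => t ^ pred k * w ^ k) = w - t ^ n * w ^ S n.
Proof.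
  induction n as [|n IH]; [simpl; ring|].
  rewrite Csum_seq_S, Cmult_plus_distr_l, IH; simpl; ring.
Qed.

(** The mean value theorem is real, so this is applied to real and imaginary parts separately. *)
Lemma is_derive_MVT_bound (f df : R -> R) (M : R) :
  (forall t, 0 <= t <= 1 -> is_derive f t (df t))%R ->
  (forall t, 0 <= t <= 1 -> Rabs (df t) <= M)%R ->
  (Rabs (f 1 - f 0) <= M)%R.
Proof.
  intros Hd HM.
  destruct (MVT_gen f 0 1 df) as [c [Hc ->]].
  - rewrite Rmin_left, Rmax_right by lra; intros; apply Hd; lra.
  - rewrite Rmin_left, Rmax_right by lra; intros x Hx.
    apply derivable_continuous_pt; exists (df x); apply is_derive_Reals, Hd; lra.
  - rewrite Rmin_left, Rmax_right in Hc by lra.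
    replace (df c * (1 - 0))%R with (df c) by ring; auto.
Qed.

(* The derivative of [sum_{k <= n} (t w)^k / k + log (1 - t w)] along the ray
   telescopes to [- t^n w^(n+1) / (1 - t w)], which is uniformly small. *)
Lemma log_series_remainder (w : C) (n : nat) : (Cmod w < 1)%R ->
  (Cmod (Csum (seq 1 n) (fun k => w ^ k / INR k)%C + Clog (1 - w))
     <= 2 * (Cmod w ^ S n / (1 - Cmod w)))%R.
Proof.
  intros Hw.
  set (F := fun t : R => Csum (seq 1 n) (fun k => (t * w) ^ k / INR k) + Clog (1 - t * w)).
  set (dF := fun t : R => - (t ^ n * w ^ S n) / (1 - t * w)).
  assert (Htw : forall t, (0 <= t <= 1 -> Cmod (t * w) <= Cmod w)%R).
  { intros t Ht; rewrite Cmod_mult, Cmod_R, Rabs_right by lra.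
    generalize (Cmod_ge_0 w); nra. }
  assert (Hlt : forall t, (0 <= t <= 1 -> Cmod (t * w) < 1)%R).
  { intros t Ht; specialize (Htw t Ht); lra. }
  assert (HdF : forall t : R, (0 <= t <= 1)%R -> dF t
    = Csum (seq 1 n) (fun k => t ^ pred k * w ^ k) + - w / (1 - t * w)).
  { intros t Ht; assert (Hn := one_minus_neq_0 _ (Hlt t Ht)).
    assert (E := geom_sum_ray w t n).
    set (S0 := Csum _ _) in *; unfold dF.
    replace (t ^ n * w ^ S n) with (w - (1 - t * w) * S0) by (rewrite E; ring).
    field; assumption. }
  assert (HF0 : F 0%R = 0).
  (* At [t = 0] every term vanishes because [k >= 1]. Zero is written as [0 * 0] so that [Csum_scal]
     pulls it out of the sum. *)
  { unfold F; rewrite (Csum_ext _ _ (fun k => 0 * 0)), Csum_scal.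
    - replace (1 - 0 * w) with (RtoC 1) by ring.
      rewrite Clog_re_pos by (simpl; lra); simpl.
      replace (1 * (1 * 1) + 0 * (0 * 1))%R with 1%R by ring.
      replace (0 / 1)%R with 0%R by field; rewrite ln_1, atan_0.
      unfold RtoC, Cmult, Cplus; simpl; f_equal; field.
    - intros k Hk; apply in_seq in Hk; destruct k; [lia|].
      simpl; unfold Cdiv; ring. }
  assert (HF1 : F 1%R = Csum (seq 1 n) (fun k => w ^ k / INR k) + Clog (1 - w)).
  { unfold F; now replace (RtoC 1 * w) with w by ring. }
  set (M := (Cmod w ^ S n / (1 - Cmod w))%R).
  assert (HM : forall t, (0 <= t <= 1 -> Cmod (dF t) <= M)%R).
  { intros t Ht; unfold dF, M.
    rewrite Cmod_div by now apply one_minus_neq_0, Hlt.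
    rewrite Cmod_opp, Cmod_mult, !Cmod_pow, Cmod_R, Rabs_right by lra.
    assert (H1 : (0 <= t ^ n <= 1)%R).
    { split; [apply pow_le; lra|]; rewrite <- (pow1 n); apply pow_incr; lra. }
    assert (H2 : (0 <= Cmod w ^ S n)%R) by (apply pow_le, Cmod_ge_0).
    assert (H3 := Cmod_one_minus (t * w)); specialize (Htw t Ht).
    apply Rmult_le_compat; [nra | | nra |].
    - left; apply Rinv_0_lt_compat; lra.
    - apply Rinv_le_contravar; lra. }
  (* Each component contributes at most [M], hence the factor 2 in the bound. *)
  rewrite <- HF1; eapply Rle_trans; [apply Cmod_le_abs|].
  assert (Hr : (Rabs (Re (F 1%R) - Re (F 0%R)) <= M)%R).
  { apply (is_derive_MVT_bound (fun t => Re (F t)) (fun t => Re (dF t))).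
    - intros t Ht; rewrite HdF by assumption.
      apply @is_derive_plus; [apply is_derive_log_sum_ray | apply is_derive_Clog_ray].
      now apply Re_one_minus_pos, Hlt.
    - intros t Ht; eapply Rle_trans; [apply re_le_Cmod | now apply HM]. }
  assert (Hi : (Rabs (Im (F 1%R) - Im (F 0%R)) <= M)%R).
  { apply (is_derive_MVT_bound (fun t => Im (F t)) (fun t => Im (dF t))).
    - intros t Ht; rewrite HdF by assumption.
      apply @is_derive_plus; [apply is_derive_log_sum_ray | apply is_derive_Clog_ray].
      now apply Re_one_minus_pos, Hlt.
    - intros t Ht; eapply Rle_trans; [apply im_le_Cmod | now apply HM]. }
  rewrite HF0, ?re_RtoC, ?im_RtoC, Rminus_0_r in Hr, Hi; lra.
Qed.

Lemma is_lim_seq_geom_tail (r : R) : (0 <= r < 1)%R ->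
  is_lim_seq (fun n => r ^ S n / (1 - r))%R 0%R.
Proof.
  intros Hr; apply is_lim_seq_ext with (fun n => r / (1 - r) * r ^ n)%R.
  - intros n; simpl; field; lra.
  - replace 0%R with (r / (1 - r) * 0)%R by ring.
    apply is_lim_seq_mult'; [apply is_lim_seq_const|].
    apply is_lim_seq_geom; rewrite Rabs_right; lra.
Qed.

Lemma is_Clim_log_series (w : C) : (Cmod w < 1)%R ->
  is_Clim (fun n => Csum (seq 1 n) (fun k => w ^ k / INR k)) (- Clog (1 - w)).
Proof.
  intros Hw; apply is_Clim_le with (fun n => 2 * (Cmod w ^ S n / (1 - Cmod w)))%R.
  - intros n; replace (Csum _ _ - - Clog (1 - w))
      with (Csum (seq 1 n) (fun k => w ^ k / INR k) + Clog (1 - w)) by ring.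
    now apply log_series_remainder.
  - replace 0%R with (2 * 0)%R by ring.
    apply is_lim_seq_mult'; [apply is_lim_seq_const|].
    apply is_lim_seq_geom_tail; generalize (Cmod_ge_0 w); lra.
Qed.

(** The terms are dominated by the geometric series of [Cmod w], so both component series converge
    and [Series] is their true sum rather than a junk value. *)
Lemma is_Clim_Li2 (w : C) : (Cmod w < 1)%R ->
  is_Clim (fun n => Csum (seq 1 n) (fun k => w ^ k / INR k ^ 2)) (Li2 w).
Proof.
  intros Hw.
  set (a := fun k => w ^ S k / INR (S k) ^ 2).
  assert (Ha : forall k, (Cmod (a k) <= Cmod w ^ k)%R).
  { intros k; unfold a.
    rewrite Cmod_div, !Cmod_pow, Cmod_R by (apply Cpow_nz, RtoC_INR_S_neq_0).
    assert (H1 : (1 <= INR (S k))%R) by (apply (le_INR 1); lia).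
    rewrite Rabs_right by lra.
    assert (H2 : (0 <= Cmod w ^ k)%R) by (apply pow_le, Cmod_ge_0).
    assert (H3 := Cmod_ge_0 w).
    revert H1 H2 H3; generalize (INR (S k)); intros x H1 H2 H3.
    apply Rle_div_l; [nra|].
    apply Rle_trans with (Cmod w ^ k * 1)%R; [rewrite <- tech_pow_Rmult; nra|].
    apply Rmult_le_compat_l; [assumption | nra]. }
  assert (Hg : ex_series (fun k => Cmod w ^ k)%R).
  { apply ex_series_geom; rewrite Rabs_right; [assumption | apply Rle_ge, Cmod_ge_0]. }
  assert (E : forall n,
    Csum (seq 1 (S n)) (fun k => w ^ k / INR k ^ 2)
    = (sum_n (fun k => Re (a k)) n, sum_n (fun k => Im (a k)) n)).
  { induction n as [|n IH].
    - rewrite !sum_O; change (a 0%nat + 0 = (Re (a 0%nat), Im (a 0%nat))).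
      rewrite Cplus_0_r; apply surjective_pairing.
    - rewrite Csum_seq_S, IH, !sum_Sn; reflexivity. }
  unfold Li2, CSeries; fold a.
  (* The sum over [1..S n] is [sum_n] up to [n] of the shifted terms, so the limit is taken along
     [S n]. *)
  apply is_Clim_components; apply is_lim_seq_incr_1.
  - apply is_lim_seq_ext with (sum_n (fun k => Re (a k))).
    + intros n; rewrite E; reflexivity.
    + apply Series_correct, @ex_series_le with (fun k => Cmod w ^ k)%R; [|exact Hg].
      intros k; eapply Rle_trans; [apply re_le_Cmod | apply Ha].
  - apply is_lim_seq_ext with (sum_n (fun k => Im (a k))).
    + intros n; rewrite E; reflexivity.
    + apply Series_correct, @ex_series_le with (fun k => Cmod w ^ k)%R; [|exact Hg].
      intros k; eapply Rle_trans; [apply im_le_Cmod | apply Ha].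
Qed.

(** * The complex exponential *)

Lemma Cexp_0 : Cexp 0 = 1.
Proof.
  unfold Cexp; simpl; rewrite exp_0, cos_0, sin_0.
  unfold RtoC, Cmult; simpl; f_equal; ring.
Qed.

Lemma Cexp_plus (u v : C) : Cexp (u + v) = Cexp u * Cexp v.
Proof.
  destruct u as [a b], v as [c d]; unfold Cexp; simpl.
  rewrite exp_plus, cos_plus, sin_plus.
  unfold RtoC, Cmult; simpl; f_equal; ring.
Qed.

Lemma Cexp_continuous (l : C) (eps : posreal) :
  exists delta : posreal, forall u, (Cmod (u - l) < delta -> Cmod (Cexp u - Cexp l) < eps)%R.
Proof.
  assert (Hfst : continuous (fun u : R * R => exp (fst u)) l).
  { apply continuous_comp; [apply continuous_fst|].
    apply (ex_derive_continuous exp); auto_derive; auto. }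
  assert (Hcos : continuous (fun u : R * R => cos (snd u)) l).
  { apply continuous_comp; [apply continuous_snd|].
    apply (ex_derive_continuous cos); auto_derive; auto. }
  assert (Hsin : continuous (fun u : R * R => sin (snd u)) l).
  { apply continuous_comp; [apply continuous_snd|].
    apply (ex_derive_continuous sin); auto_derive; auto. }
  assert (H1 := continuous_mult _ _ _ Hfst Hcos).
  assert (H2 := continuous_mult _ _ _ Hfst Hsin).
  set (e := mkposreal (eps / 2) (is_pos_div_2 eps)).
  destruct (H1 _ (locally_ball _ e)) as [d1 Hd1].
  destruct (H2 _ (locally_ball _ e)) as [d2 Hd2].
  exists (mkposreal _ (Rmin_pos _ _ (cond_pos d1) (cond_pos d2))); simpl; intros u Hu.
  (* Balls of [R * R] are boxes, so a small modulus of [u - l] suffices for both coordinates. *)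
  assert (Hball : forall d : posreal, (Rmin d1 d2 <= d)%R -> ball (l : R * R) d u).
  { intros d Hd; split.
    - eapply Rle_lt_trans; [apply (re_le_Cmod (u - l)) | lra].
    - eapply Rle_lt_trans; [apply (im_le_Cmod (u - l)) | lra]. }
  assert (Hr := Hd1 u (Hball d1 (Rmin_l _ _))).
  assert (Hi := Hd2 u (Hball d2 (Rmin_r _ _))).
  assert (E : forall v, Cexp v = (exp (fst v) * cos (snd v), exp (fst v) * sin (snd v))%R).
  { intros v; unfold Cexp, Cmult, RtoC, Re, Im; simpl; f_equal; ring. }
  eapply Rle_lt_trans; [apply Cmod_le_abs|].
  rewrite !E.
  replace (pos eps) with (eps / 2 + eps / 2)%R by field.
  apply Rplus_lt_compat; [exact Hr | exact Hi].
Qed.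

(** * Unconditional sums and products *)

(** The additive counterpart of [is_Cprod], over the same finite subsets ordered by inclusion, so
    that exponentiation carries one to the other. *)
Definition is_Csum {I : Type} (P : I -> Prop) (f : I -> C) (l : C) : Prop :=
  forall eps : posreal, exists s0 : list I,
    NoDup s0 /\ List.Forall P s0 /\
    forall s : list I, NoDup s -> List.Forall P s -> incl s0 s ->
      (Cmod (Csum s f - l) < eps)%R.

Lemma is_Csum_opp {I} (P : I -> Prop) f l :
  is_Csum P f l -> is_Csum P (fun i => - f i) (- l).
Proof.
  intros H eps; destruct (H eps) as [s0 [H1 [H2 H3]]].
  exists s0; repeat split; auto; intros s Hs HP Hi.
  rewrite Csum_opp, <- Cmod_opp.
  replace (- (- Csum s f - - l)) with (Csum s f - l) by ring; auto.
Qed.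

(** A finite product is the exponential of the finite sum, and continuity of [Cexp] at [l] transfers
    the convergence with the same witness [s0]. *)
Lemma is_Cprod_Cexp {I} (P : I -> Prop) f g l :
  (forall i, P i -> g i = Cexp (f i)) -> is_Csum P f l -> is_Cprod P g (Cexp l).
Proof.
  intros Hg H eps.
  destruct (Cexp_continuous l eps) as [delta Hd].
  destruct (H delta) as [s0 [H1 [H2 H3]]].
  exists s0; repeat split; auto; intros s Hs HP Hi.
  replace (Cprod s g) with (Cexp (Csum s f)); [now apply Hd, H3|].
  clear Hs Hi; induction HP as [|i s Hi HP IH]; simpl; [apply Cexp_0|].
  now rewrite Cexp_plus, IH, Hg.
Qed.

(** * Coprime pairs and their multiples *)

Definition triangle (K : nat) : list (nat * nat) :=
  flat_map (fun n => map (fun m => (m, n)) (seq 1 n)) (seq 1 K).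

Lemma in_triangle K m n : In (m, n) (triangle K) <-> (1 <= m <= n /\ n <= K)%nat.
Proof.
  unfold triangle; rewrite in_flat_map; split.
  - intros [n' [Hn H]]; apply in_map_iff in H; destruct H as [m' [[= -> ->] Hm]].
    apply in_seq in Hn, Hm; lia.
  - intros H; exists n; split; [apply in_seq; lia|].
    apply in_map_iff; exists m; split; [reflexivity | apply in_seq; lia].
Qed.

Lemma triangle_S K :
  triangle (S K) = triangle K ++ map (fun m => (m, S K)) (seq 1 (S K)).
Proof.
  unfold triangle; rewrite (seq_S K) at 1; rewrite flat_map_app.
  f_equal; apply app_nil_r.
Qed.

Lemma NoDup_triangle K : NoDup (triangle K).
Proof.
  induction K as [|K IH]; [constructor|].
  rewrite triangle_S; apply NoDup_app; [assumption| |].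
  - apply NoDup_map_NoDup_ForallPairs; [|apply seq_NoDup].
    intros a b _ _ [=]; assumption.
  - intros [m n] H1 H2; apply in_triangle in H1.
    apply in_map_iff in H2; destruct H2 as [m' [[= -> <-] _]]; lia.
Qed.

(** The rays through the pairs of [s], cut at multiplier [J]: the index set of the logarithm series
    of these pairs truncated at order [J]. *)
Definition multiples (J : nat) (s : list (nat * nat)) : list (nat * nat) :=
  flat_map (fun p => map (fun k => (k * fst p, k * snd p)%nat) (seq 1 J)) s.

Lemma in_multiples J s m n : In (m, n) (multiples J s) <->
  exists k a b, (1 <= k <= J)%nat /\ In (a, b) s /\ m = (k * a)%nat /\ n = (k * b)%nat.
Proof.
  unfold multiples; rewrite in_flat_map; split.
  - intros [[a b] [Hs H]]; apply in_map_iff in H; destruct H as [k [[= <- <-] Hk]].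
    apply in_seq in Hk; exists k, a, b; repeat split; auto; lia.
  - intros [k [a [b [Hk [Hs [-> ->]]]]]]; exists (a, b); split; [assumption|].
    apply in_map_iff; exists k; split; [reflexivity | apply in_seq; lia].
Qed.

(* A pair determines its coprime generator and the multiplier, the latter as its gcd. *)
Lemma NoDup_multiples J s :
  NoDup s -> List.Forall coprime_le_pair s -> NoDup (multiples J s).
Proof.
  induction 1 as [|[a b] s Hn Hs IH]; intros HF; [constructor|].
  inversion HF as [|? ? Hab HF']; subst; destruct Hab as [Ha [Hb [_ Hg]]].
  unfold multiples; simpl; apply NoDup_app; [| now apply IH |].
  - apply NoDup_map_NoDup_ForallPairs; [|apply seq_NoDup].
    intros i j _ _ [= H _]; nia.
  - intros [m n] H1 H2; apply in_map_iff in H1; destruct H1 as [k [[= <- <-] Hk]].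
    apply in_seq in Hk.
    apply in_multiples in H2; destruct H2 as [k' [a' [b' [Hk' [H' [E1 E2]]]]]].
    rewrite Forall_forall in HF'; destruct (HF' _ H') as [_ [_ [_ Hg']]].
    assert (Ek : k = k').
    { rewrite <- (Nat.mul_1_r k), <- (Nat.mul_1_r k'), <- Hg at 1; rewrite <- Hg'.
      rewrite <- !Nat.gcd_mul_mono_l; congruence. }
    subst k'; apply Hn.
    replace a with a' by nia; replace b with b' by nia; assumption.
Qed.

(** The multiplier [k] is the gcd. The bounds by [n] ensure that a pair of the triangle [K] has its
    generator in that triangle and its multiplier at most [K]. *)
Lemma coprime_generator m n : (1 <= m <= n)%nat ->
  exists k a b, (1 <= k <= n /\ b <= n)%nat /\ coprime_le_pair (a, b) /\
    m = (k * a)%nat /\ n = (k * b)%nat.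
Proof.
  intros H.
  assert (Hg : Nat.gcd m n <> 0%nat) by (rewrite Nat.gcd_eq_0; lia).
  destruct (Nat.gcd_divide_l m n) as [a Ha], (Nat.gcd_divide_r m n) as [b Hb].
  assert (Hab : Nat.gcd a b = 1%nat).
  { apply Nat.mul_cancel_l with (Nat.gcd m n); [assumption|].
    rewrite <- Nat.gcd_mul_mono_l, (Nat.mul_comm _ a), (Nat.mul_comm _ b), <- Ha, <- Hb.
    lia. }
  set (g := Nat.gcd m n) in *; clearbody g.
  assert (Ha0 : a <> 0%nat) by (intros ->; lia).
  assert (Hb0 : b <> 0%nat) by (intros ->; lia).
  assert (Hle : (a <= b)%nat) by (apply Nat.mul_le_mono_pos_r with g; lia).
  exists g, a, b; unfold coprime_le_pair; repeat split; auto; try nia.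
Qed.

(** * The double series and its comparison with coprime pairs *)

Definition term (y z : C) (p : nat * nat) : C :=
  RtoC (INR (fst p) / INR (snd p) ^ 2) * (y ^ fst p * z ^ snd p).

Lemma Rsum_le {I} (s : list I) f g :
  (forall i, In i s -> f i <= g i)%R -> (Rsum s f <= Rsum s g)%R.
Proof.
  induction s as [|i s IH]; simpl; intros H; [lra|].
  apply Rplus_le_compat; auto.
Qed.

Lemma Rsum_const {I} (s : list I) c : Rsum s (fun _ => c) = (INR (length s) * c)%R.
Proof.
  induction s as [|i s IH]; [simpl; ring|].
  change (length (i :: s)) with (S (length s)); rewrite S_INR; simpl; rewrite IH; ring.
Qed.

(** With [N = S n], each of the [N] entries is at most [Cmod z ^ N / N], since [m / N^2 <= 1 / N]
    and [Cmod y ^ m <= 1]. *)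
Lemma Rsum_row_term (y z : C) n : (Cmod y < 1)%R ->
  (Rsum (map (fun m => (m, S n)) (seq 1 (S n))) (fun p => Cmod (term y z p))
    <= Cmod z ^ S n)%R.
Proof.
  intros Hy; rewrite Rsum_map.
  assert (Hn : (0 < INR (S n))%R) by (apply lt_0_INR; lia).
  assert (Hz : (0 <= Cmod z ^ S n)%R) by (apply pow_le, Cmod_ge_0).
  apply Rle_trans with (Rsum (seq 1 (S n)) (fun _ => / INR (S n) * Cmod z ^ S n)%R).
  - apply Rsum_le; intros m Hm; apply in_seq in Hm; unfold term; simpl fst; simpl snd.
    rewrite !Cmod_mult, !Cmod_pow, Cmod_R.
    assert (Hm' : (0 <= INR m <= INR (S n))%R) by (split; [apply pos_INR | apply le_INR; lia]).
    assert (Hy' : (0 <= Cmod y ^ m <= 1)%R).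
    { split; [apply pow_le, Cmod_ge_0|]; rewrite <- (pow1 m); apply pow_incr.
      split; [apply Cmod_ge_0 | lra]. }
    revert Hn Hm'; generalize (INR (S n)) (INR m); intros N M Hn Hm'.
    assert (HM : (0 <= M / N ^ 2 <= / N)%R).
    { split; [apply Rle_div_r; nra|]; apply Rle_div_l; [nra|].
      replace (/ N * N ^ 2)%R with N by (field; lra); lra. }
    rewrite Rabs_right by lra.
    apply Rmult_le_compat; nra.
  - rewrite Rsum_const, length_seq; apply Req_le; field; lra.
Qed.

Lemma triangle_abs_tail (y z : C) K d : (Cmod y < 1)%R -> (Cmod z < 1)%R ->
  (Rsum (triangle (d + K)) (fun p => Cmod (term y z p))
   - Rsum (triangle K) (fun p => Cmod (term y z p)) <= Cmod z ^ S K / (1 - Cmod z))%R.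
Proof.
  intros Hy Hz.
  (* The exact finite geometric sum is used because, unlike the full tail, it carries an induction
     on [d]. *)
  apply Rle_trans with ((Cmod z ^ S K - Cmod z ^ S (d + K)) / (1 - Cmod z))%R.
  - induction d as [|d IH].
    + simpl; apply Req_le; field; lra.
    + simpl Nat.add; rewrite triangle_S, Rsum_app.
      assert (H := Rsum_row_term y z (d + K) Hy).
      replace ((Cmod z ^ S K - Cmod z ^ S (S (d + K))) / (1 - Cmod z))%R
        with ((Cmod z ^ S K - Cmod z ^ S (d + K)) / (1 - Cmod z) + Cmod z ^ S (d + K))%R
        by (simpl; field; lra).
      lra.
  - apply Rmult_le_compat_r; [left; apply Rinv_0_lt_compat; lra|].
    assert (H : (0 <= Cmod z ^ S (d + K))%R) by (apply pow_le, Cmod_ge_0); lra.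
Qed.

(* For [J >= K] the multiples of [s] fill the triangle [K]; what sticks out of it
   is controlled by the tail of the absolutely convergent double series. *)
Lemma Csum_multiples_triangle (y z : C) K J s :
  (Cmod y < 1)%R -> (Cmod z < 1)%R -> (K <= J)%nat ->
  NoDup s -> List.Forall coprime_le_pair s ->
  (forall p, In p (triangle K) -> coprime_le_pair p -> In p s) ->
  (Cmod (Csum (multiples J s) (term y z) - Csum (triangle K) (term y z))
     <= Cmod z ^ S K / (1 - Cmod z))%R.
Proof.
  intros Hy Hz HJ Hs HF Hi.
  assert (Hinc : incl (triangle K) (multiples J s)).
  { intros [m n] H; apply in_triangle in H.
    destruct (coprime_generator m n) as [k [a [b [Hk [Hc [E1 E2]]]]]]; [lia|].
    apply in_multiples; exists k, a, b; repeat split; auto; try lia.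
    apply Hi; [|assumption]; apply in_triangle; destruct Hc as [? [? [? _]]]; lia. }
  assert (Hbig : exists d, incl (multiples J s) (triangle (d + K))).
  (* A crude bound: each second coordinate in [s] is at most their total, and each multiplier at
     most [J]. *)
  { exists (J * list_sum (map snd s))%nat; intros [m n] H.
    apply in_multiples in H; destruct H as [k [a [b [Hk [Hin [-> ->]]]]]].
    rewrite Forall_forall in HF; destruct (HF _ Hin) as [? [? [? _]]].
    assert (Hb : (b <= list_sum (map snd s))%nat).
    { clear - Hin; induction s as [|[a' b'] s IH]; [destruct Hin|].
      destruct Hin as [[= -> ->]|Hin]; simpl; [lia | specialize (IH Hin); lia]. }
    apply in_triangle; repeat split; nia. }
  destruct Hbig as [d Hbig].
  eapply Rle_trans; [apply Cmod_Csum_incl_sub; [apply NoDup_triangle | assumption]|].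
  eapply Rle_trans; [|now apply (triangle_abs_tail y z K d)].
  apply Rplus_le_compat_r, Rsum_incl; auto.
  - intros; apply Cmod_ge_0.
  - now apply NoDup_multiples.
Qed.

Lemma Cmod_monomial_lt_1 (y z : C) m n :
  (Cmod y < 1)%R -> (Cmod z < 1)%R -> (1 <= m)%nat -> (Cmod (y ^ m * z ^ n) < 1)%R.
Proof.
  intros Hy Hz Hm; rewrite Cmod_mult, !Cmod_pow.
  assert (H1 : (0 <= Cmod z ^ n <= 1)%R).
  { split; [apply pow_le, Cmod_ge_0|]; rewrite <- (pow1 n); apply pow_incr.
    split; [apply Cmod_ge_0 | lra]. }
  assert (H2 : (0 <= Cmod y ^ m < 1)%R).
  { split; [apply pow_le, Cmod_ge_0|]; apply pow_lt_1_compat; [|lia].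
    split; [apply Cmod_ge_0 | assumption]. }
  nra.
Qed.

(** The weight is homogeneous of degree -1: [(k a) / (k b)^2 = (a / b^2) / k]. Along a ray the
    double series is therefore a weighted logarithm series. *)
Lemma is_Clim_ray (y z : C) a b :
  (Cmod y < 1)%R -> (Cmod z < 1)%R -> coprime_le_pair (a, b) ->
  is_Clim (fun J => Csum (map (fun k => (k * a, k * b)%nat) (seq 1 J)) (term y z))
    (RtoC (INR a / INR b ^ 2) * - Clog (1 - y ^ a * z ^ b)).
Proof.
  intros Hy Hz [Ha [Hb _]].
  apply is_Clim_ext with (fun J =>
    RtoC (INR a / INR b ^ 2) * Csum (seq 1 J) (fun k => (y ^ a * z ^ b) ^ k / INR k)).
  - intros J; rewrite Csum_map, <- Csum_scal; apply Csum_ext.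
    intros k Hk; apply in_seq in Hk; unfold term; simpl fst; simpl snd.
    assert (Hk' : INR k <> 0%R) by (apply not_0_INR; lia).
    assert (Hb' : INR b <> 0%R) by (apply not_0_INR; lia).
    rewrite Cpow_mult_l, !(Nat.mul_comm k), !Cpow_mult_r.
    replace (INR (a * k) / INR (b * k) ^ 2)%R with (INR a / INR b ^ 2 * / INR k)%R.
    + rewrite RtoC_mult, RtoC_inv by assumption; unfold Cdiv; ring.
    + rewrite !mult_INR; field; auto.
  - apply is_Clim_scal, is_Clim_log_series, Cmod_monomial_lt_1; assumption.
Qed.

Lemma is_lim_seq_0_eventually_lt (u : nat -> R) (eps : posreal) :
  is_lim_seq u 0%R -> exists N, forall n, (N <= n)%nat -> (u n < eps)%R.
Proof.
  intros H; apply is_lim_seq_spec in H; destruct (H eps) as [N HN].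
  exists N; intros n Hn; specialize (HN n Hn).
  rewrite Rminus_0_r in HN; apply Rabs_lt_between in HN; lra.
Qed.

(** An argument in three parts of [eps / 3]: weighted logarithms against truncated rays, truncated
    rays against the triangle [K], and that triangle against [l]. Here [K] depends on [eps] alone,
    whereas [J] may depend on [s]. *)
Lemma is_Csum_coprime (y z l : C) : (Cmod y < 1)%R -> (Cmod z < 1)%R ->
  is_Clim (fun K => Csum (triangle K) (term y z)) l ->
  is_Csum coprime_le_pair
    (fun p => RtoC (INR (fst p) / INR (snd p) ^ 2)
              * - Clog (1 - y ^ fst p * z ^ snd p)) l.
Proof.
  intros Hy Hz Hl eps.
  assert (He : (0 < eps / 3)%R) by (generalize (cond_pos eps); lra).
  set (e := mkposreal _ He).
  destruct (is_lim_seq_0_eventually_lt _ e Hl) as [K1 HK1].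
  destruct (is_lim_seq_0_eventually_lt (fun n => Cmod z ^ S n / (1 - Cmod z))%R e)
    as [K2 HK2].
  { apply is_lim_seq_geom_tail; split; [apply Cmod_ge_0 | assumption]. }
  set (K := Nat.max K1 K2).
  specialize (HK1 K (Nat.le_max_l _ _)); specialize (HK2 K (Nat.le_max_r _ _)).
  set (cop := fun p : nat * nat => Nat.eqb (Nat.gcd (fst p) (snd p)) 1).
  (* The coprime pairs of the triangle generate all of its pairs, so any larger [s] has multiples
     covering it. *)
  exists (filter cop (triangle K)); repeat split.
  - apply NoDup_filter, NoDup_triangle.
  - apply Forall_forall; intros [m n] H; apply filter_In in H; destruct H as [H Hc].
    apply in_triangle in H; apply Nat.eqb_eq in Hc; simpl in *; lia.
  - intros s Hs HF Hi.
    set (f := fun p => _).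
    assert (Hlim : is_Clim (fun J => Csum (multiples J s) (term y z)) (Csum s f)).
    { eapply is_Clim_ext; [intros J; symmetry; apply Csum_flat_map|].
      apply is_Clim_Csum; intros [a b] Hp.
      apply is_Clim_ray; auto; rewrite Forall_forall in HF; now apply HF. }
    destruct (is_lim_seq_0_eventually_lt _ e Hlim) as [J0 HJ0].
    (* At least [J0] for the convergence along the rays, at least [K] so that the multiples fill the
       triangle. *)
    set (J := Nat.max J0 K).
    specialize (HJ0 J (Nat.le_max_l _ _)).
    assert (HT : (Cmod (Csum (multiples J s) (term y z) - Csum (triangle K) (term y z))
                   <= Cmod z ^ S K / (1 - Cmod z))%R).
    { apply Csum_multiples_triangle; auto; [apply Nat.le_max_r|].
      intros [m n] H [_ [_ [_ Hc]]]; apply Hi, filter_In; split; [assumption|].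
      now apply Nat.eqb_eq. }
    set (A := Csum (multiples J s) (term y z)) in *.
    set (T := Csum (triangle K) (term y z)) in *.
    replace (Csum s f - l) with (- (A - Csum s f) + (A - T) + (T - l)) by ring.
    eapply Rle_lt_trans; [apply Cmod_triangle|].
    generalize (Cmod_triangle (- (A - Csum s f)) (A - T)); rewrite Cmod_opp.
    change (pos e) with (eps / 3)%R in HJ0, HK1, HK2; lra.
Qed.

(** * The closed form *)

(** The arithmetic-geometric sum with denominators cleared, so that the induction is a ring
    identity. *)
Lemma row_sum (y : C) n :
  (1 - y) ^ 2 * Csum (seq 1 n) (fun m => INR m * y ^ m)
    = y * (1 - y ^ n - INR n * y ^ n * (1 - y)).
Proof.
  induction n as [|n IH]; [simpl; ring|].
  rewrite Csum_seq_S, Cmult_plus_distr_l, IH, S_INR, RtoC_plus, (Cpow_S y n); ring.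
Qed.

(** By [row_sum], row [N] equals [y / (1-y)^2 * (z^N - (y z)^N) / N^2 - y / (1-y) * (y z)^N / N];
    these are the terms of two dilogarithms and a logarithm. The factor [-1] replaces a subtraction
    to match the limit rules for sums and scalar multiples. *)
Lemma Csum_triangle (y z : C) K : 1 - y <> 0 ->
  Csum (triangle K) (term y z)
    = y / (1 - y) ^ 2 * (Csum (seq 1 K) (fun n => z ^ n / INR n ^ 2)
                         + (-1) * Csum (seq 1 K) (fun n => (y * z) ^ n / INR n ^ 2))
      + - (y / (1 - y)) * Csum (seq 1 K) (fun n => (y * z) ^ n / INR n).
Proof.
  intros Hy; induction K as [|K IH]; [simpl; ring|].
  rewrite triangle_S, Csum_app, IH, !Csum_seq_S, Csum_map.
  assert (HK := RtoC_INR_S_neq_0 K).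
  assert (HK' : INR (S K) <> 0%R) by (apply not_0_INR; discriminate).
  rewrite (Csum_ext _ (fun m => term y z (m, S K))
    (fun m => z ^ S K / INR (S K) ^ 2 * (INR m * y ^ m))).
  - rewrite Csum_scal.
    assert (E := row_sum y (S K)).
    set (R0 := Csum (seq 1 (S K)) _) in *.
    replace R0 with (y * (1 - y ^ S K - INR (S K) * y ^ S K * (1 - y)) / (1 - y) ^ 2)
      by (rewrite <- E; field; assumption).
    rewrite Cpow_mult_l; field; auto.
  - intros m _; unfold term; simpl fst; simpl snd.
    rewrite RtoC_div, RtoC_pow by now apply pow_nonzero.
    field; assumption.
Qed.

Lemma is_Clim_triangle (y z : C) : (Cmod y < 1)%R -> (Cmod z < 1)%R ->
  is_Clim (fun K => Csum (triangle K) (term y z))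
    (y / (1 - y) ^ 2 * (Li2 z - Li2 (y * z)) + y / (1 - y) * Clog (1 - y * z)).
Proof.
  intros Hy Hz.
  assert (Hyz : (Cmod (y * z) < 1)%R).
  { rewrite Cmod_mult; generalize (Cmod_ge_0 y) (Cmod_ge_0 z); nra. }
  eapply is_Clim_ext;
    [intros K; symmetry; apply Csum_triangle; now apply one_minus_neq_0|].
  replace (y / (1 - y) ^ 2 * (Li2 z - Li2 (y * z)) + y / (1 - y) * Clog (1 - y * z))
    with (y / (1 - y) ^ 2 * (Li2 z + (-1) * Li2 (y * z))
          + - (y / (1 - y)) * - Clog (1 - y * z)) by ring.
  apply is_Clim_plus; apply is_Clim_scal.
  - apply is_Clim_plus; [|apply is_Clim_scal]; now apply is_Clim_Li2.
  - now apply is_Clim_log_series.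
Qed.

Theorem theorem23 (y z : C) (hy : Cmod y < 1) (hz : Cmod z < 1) :
  is_Cprod coprime_le_pair
    (fun p => let (m, n) := p in
      Cpower (1 / (1 - y ^ m * z ^ n)) (RtoC (INR m / INR n ^ 2)%R))
    (Cpower (1 - y * z) (y / (1 - y))
       * Cexp (y / (1 - y) ^ 2 * (Li2 z - Li2 (y * z))))
  /\
  is_Cprod coprime_le_pair
    (fun p => let (m, n) := p in
      Cpower (1 - y ^ m * z ^ n) (RtoC (INR m / INR n ^ 2)%R))
    (Cpower (1 / (1 - y * z)) (y / (1 - y))
       * Cexp (- (y / (1 - y) ^ 2) * (Li2 z - Li2 (y * z)))).
Proof.
  assert (Hs := is_Csum_coprime y z _ hy hz (is_Clim_triangle y z hy hz)).
  (* Every [1 - y^m z^n] lies in the right half plane, so no branch jump occurs on inversion. *)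
  assert (Hinv : forall m n, (1 <= m)%nat ->
    Clog (1 / (1 - y ^ m * z ^ n)) = - Clog (1 - y ^ m * z ^ n)).
  { intros m n Hm; apply Clog_inv, Re_one_minus_pos.
    now apply Cmod_monomial_lt_1. }
  split.
  - unfold Cpower at 2; rewrite <- Cexp_plus, Cplus_comm.
    apply is_Cprod_Cexp with (2 := Hs); intros [m n] [Hm _].
    unfold Cpower; now rewrite Hinv.
  - unfold Cpower at 2; rewrite <- Cexp_plus.
    (* The case [m = n = 1] treats the base [1 / (1 - y z)] of the closed form, whose exponent
       becomes the opposite of the first one. *)
    assert (E := Hinv 1%nat 1%nat (le_n 1)); rewrite !Cpow_1_r in E; rewrite E.
    replace (y / (1 - y) * - Clog (1 - y * z)
             + - (y / (1 - y) ^ 2) * (Li2 z - Li2 (y * z)))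
      with (- (y / (1 - y) ^ 2 * (Li2 z - Li2 (y * z)) + y / (1 - y) * Clog (1 - y * z)))
      by ring.
    apply is_Cprod_Cexp with (2 := is_Csum_opp _ _ _ Hs); intros [m n] _.
    unfold Cpower; f_equal; simpl fst; simpl snd; ring.
Qed.
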